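(* Let $D$ be a chord diagram and let $G$ be the ribbon graph associated to $D$, so that the edge-ribbons $E(G)$ are in bijection with the chords of $D$. Then the partial-dual genus polynomial of $G$ satisfies \[ {}^\partial\varepsilon_{G}(z)=\sum_{A\subseteq E(G)} z^{\operatorname{rank}(M_A)+\operatorname{rank}(M_{A^c})}, \] where $A^c=E(G)\setminus A$.
   Context: A chord diagram is an oriented circle with finitely many chords inside it, with pairwise distinct endpoints. The ribbon graph $G$ associated to a chord diagram $D$ is obtained by attaching a disc (the single vertex-disc) to the circle and thickening each chord to an untwisted ribbon (edge-ribbon); $G$ is an orientable ribbon graph with one vertex. For a ribbon graph $G$ with vertex-discs $V(G)$, edge-ribbons $E(G)$, boundary components (face-discs) $F(G)$ and $c(G)$ connected components, its Euler genus is $\varepsilon(G)=2c(G)-|V(G)|+|E(G)|-|F(G)|$. For $A\subseteq E(G)$, the partial dual $G^A$ is defined as follows: let $F_A$ be the ribbon subgraph consisting of all vertex-discs and the edge-ribbons in $A$; glue a disc to each boundary component of $F_A$, and remove the interiors of the original vertex-discs; the result is $G^A$, whose vertex-discs are the glued discs and whose edge set is $E(G)$. The partial-dual genus polynomial is ${}^\partial\varepsilon_G(z)=\sum_{A\subseteq E(G)} z^{\varepsilon(G^A)}$. The intersection graph of a chord diagram has one vertex per chord, two vertices being adjacent iff the corresponding chords intersect. For a set $A$ of chords of $D$, $M_A$ is the adjacency matrix (with entries in $\mathbb{Z}_2$ and zero diagonal) of the intersection graph of the chord diagram obtained from $D$ by deleting all chords not in $A$; $\operatorname{rank}$ denotes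 rank over $\mathbb{Z}_2$, and the rank of the empty ($0\times 0$) matrix is $0$. *)

(* Defs.v *)
From HB Require Import structures.
From mathcomp Require Import all_boot all_order all_algebra.

Set Implicit Arguments.
Unset Strict Implicit.
Unset Printing Implicit Defensive.

Import Order.TTheory GRing.Theory Num.Theory.
Local Open Scope ring_scope.

(** * Chord diagrams *)

(* [C] is the set of chords. The two endpoints of the chord [c] are [(c, false)]
   and [(c, true)] (an arbitrary labelling), and [endpoints] lists all of them
   in the order in which they are met along the oriented circle; the sequence
   is to be read cyclically, i.e. through [next] and [prev]. *)
Record chord_diagram (C : finType) := ChordDiagram {
  endpoints : seq (C * bool);
  endpoints_uniq : uniq endpoints;
  mem_endpoints : forall x, x \in endpoints
}.

Section ChordDiagram.
Variables (C : finType) (D : chord_diagram C).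

Definition between (x y z : C * bool) : bool :=
  let p u := index u (endpoints D) in
  (p x < p z < p y)%N || (p y < p z < p x)%N.

(* Two chords intersect iff the endpoints of the second one lie on different
   arcs of the circle cut by the endpoints of the first one. In particular
   [intersection_graph a a = false]. *)
Definition intersection_graph : rel C := fun a b =>
  between (a, false) (a, true) (b, false)
    (+) between (a, false) (a, true) (b, true).

Definition adjacency_mx : 'M['F_2]_#|C| :=
  \matrix_(i, j) (intersection_graph (enum_val i) (enum_val j))%:R.

Definition restrict_endpoint (A : {set C}) (x : C * bool) :
    option ({c : C | c \in A} * bool) :=
  omap (fun c => (c, x.2)) (insub x.1).

Lemma restrict_endpointK (A : {set C}) :
  ocancel (@restrict_endpoint A) (fun y => (val y.1, y.2)).
Proof. by case=> c b; rewrite /restrict_endpoint /=; case: insubP => //= u _ ->. Qed.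

Lemma restrict_uniq (A : {set C}) :
  uniq (pmap (@restrict_endpoint A) (endpoints D)).
Proof. exact: (pmap_uniq (@restrict_endpointK A)) (endpoints_uniq D). Qed.

Lemma mem_restrict (A : {set C}) (y : {c : C | c \in A} * bool) :
  y \in pmap (@restrict_endpoint A) (endpoints D).
Proof.
rewrite mem_pmap; apply/mapP; exists (val y.1, y.2); first exact: mem_endpoints.
by case: y => c b; rewrite /restrict_endpoint /= valK.
Qed.

(* The diagram obtained by deleting the chords that are not in [A]. *)
Definition restrict_diagram (A : {set C}) : chord_diagram {c : C | c \in A} :=
  ChordDiagram (@restrict_uniq A) (@mem_restrict A).

End ChordDiagram.

(** * Ribbon graphs *)

(* The edge-ribbon [e] is a rectangle with corners [(e, i, j)]: the corners with
   the same [i] bound one of the two ends, along which the ribbon is attached to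
   a vertex-disc, and the corners with the same [j] bound one of the two free
   sides. *)
Definition corner (E : finType) : finType := (E * bool * bool)%type.

Definition ribbon_end (E : finType) (c : corner E) : corner E :=
  (c.1, ~~ c.2).

Definition ribbon_side (E : finType) (c : corner E) : corner E :=
  ((c.1.1, ~~ c.1.2), c.2).

(* The corners cut the boundaries of the vertex-discs into attaching arcs (the
   ends of the ribbons) and free arcs; [free_arc] exchanges the two extremities
   of a free arc. These data determine the ribbon graph (orientable or not) up
   to the vertex-discs to which no ribbon is attached, which are counted by
   [bare_discs]. *)
Record ribbon_graph (E : finType) := RibbonGraph {
  free_arc : corner E -> corner E;
  free_arcK : involutive free_arc;
  free_arc_neq : forall c, free_arc c != c;
  bare_discs : nat
}.

Section RibbonGraph.
Variables (E : finType).
Implicit Types (G : ribbon_graph E) (A : {set E}).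

(* The boundary of a vertex-disc alternates free and attaching arcs. *)
Definition vertex_step G (c : corner E) : seq (corner E) :=
  [:: free_arc G c; ribbon_end c].

Definition num_vertices G : nat :=
  (n_comp (grel (vertex_step G)) predT + bare_discs G)%N.

(* The boundary of the ribbon subgraph [F_A] runs along the free arcs, the sides
   of the ribbons in [A], and the arcs left free by the ribbons not in [A]. *)
Definition boundary_step G A (c : corner E) : seq (corner E) :=
  [:: free_arc G c; if c.1.1 \in A then ribbon_side c else ribbon_end c].

Definition num_boundary_components G A : nat :=
  (n_comp (grel (boundary_step G A)) predT + bare_discs G)%N.

Definition num_faces G : nat := num_boundary_components G [set: E].

Definition component_step G (c : corner E) : seq (corner E) :=
  [:: free_arc G c; ribbon_end c; ribbon_side c].

Definition num_components G : nat :=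
  (n_comp (grel (component_step G)) predT + bare_discs G)%N.

Definition euler_genus G : int :=
  (2 * num_components G)%N%:Z - (num_vertices G)%:Z + #|E|%:Z
    - (num_faces G)%:Z.

(* Gluing discs to the boundary components of [F_A] and removing the original
   vertex-discs leaves the ribbons in place, but those in [A] are now attached
   along their former sides: their ends and sides are exchanged. *)
Definition swap_ends A (c : corner E) : corner E :=
  if c.1.1 \in A then ((c.1.1, c.2), c.1.2) else c.

Lemma swap_endsK A : involutive (swap_ends A).
Proof. by case=> [[e i] j]; rewrite /swap_ends /=; case eA: (e \in A); rewrite /= eA. Qed.

Definition dual_free_arc G A : corner E -> corner E :=
  swap_ends A \o free_arc G \o swap_ends A.

Lemma dual_free_arcK G A : involutive (dual_free_arc G A).
Proof. by move=> c; rewrite /dual_free_arc /= swap_endsK free_arcK swap_endsK. Qed.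

Lemma dual_free_arc_neq G A c : dual_free_arc G A c != c.
Proof.
by rewrite /dual_free_arc /= (can2_eq (swap_endsK A) (swap_endsK A)) free_arc_neq.
Qed.

Definition partial_dual G A : ribbon_graph E :=
  RibbonGraph (dual_free_arcK G A) (dual_free_arc_neq G A) (bare_discs G).

(* [`|_|] is harmless: the Euler genus is nonnegative, see [euler_genus_ge0]. *)
Definition partial_dual_genus_poly G : {poly int} :=
  \sum_(A : {set E}) 'X^(`|euler_genus (partial_dual G A)|%N).

End RibbonGraph.

(** * The ribbon graph of a chord diagram *)

Section RibbonGraphOf.
Variables (C : finType) (D : chord_diagram C).

(* Around the endpoint [x = (c, i)] the circle first meets the corner [(x, i)]
   and then the corner [(x, ~~ i)] of the ribbon [c]; thus each side of [c] joins
   a first corner to a second one, i.e. the ribbon is untwisted. The free arcs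
   run from the second corner at an endpoint to the first corner at the next. *)
Definition circle_free_arc (c : corner C) : corner C :=
  let: (x, j) := c in
  if j == x.2 then let y := prev (endpoints D) x in (y, ~~ y.2)
  else let y := next (endpoints D) x in (y, y.2).

Lemma circle_free_arcK : involutive circle_free_arc.
Proof.
have Us := endpoints_uniq D.
case=> [x j]; rewrite {2}/circle_free_arc.
have [->|jx] := eqVneq j x.2; rewrite /circle_free_arc.
  rewrite next_prev //; case: eqP => //.
  by case: (prev _ x).2.
by rewrite eqxx prev_next //; case: x.2 j jx => [] [].
Qed.

Lemma circle_free_arc_neq c : circle_free_arc c != c.
Proof.
case: c => [x j]; rewrite /circle_free_arc.
have [->|jx] := eqVneq j x.2; apply/eqP=> -[].
  by move=> ->; case: x.2.
by move=> -> jE; rewrite jE eqxx in jx.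
Qed.

(* When there is no chord the unique vertex-disc carries no ribbon. *)
Definition ribbon_graph_of : ribbon_graph C :=
  RibbonGraph circle_free_arcK circle_free_arc_neq (#|C| == 0)%N.

End RibbonGraphOf.

(** * Consistency of the definitions *)

Section Checks.
Variable (E : finType).
Implicit Types (G : ribbon_graph E) (A : {set E}).

Lemma ribbon_endK : involutive (@ribbon_end E).
Proof. by case=> [[e i] j]; rewrite /ribbon_end /= negbK. Qed.

Lemma ribbon_sideK : involutive (@ribbon_side E).
Proof. by case=> [[e i] j]; rewrite /ribbon_side /= negbK. Qed.

Let inv_eq_swap (T : eqType) (f : T -> T) (fK : involutive f) x y :
  (x == f y) = (y == f x).
Proof. by rewrite -(inv_eq fK) eq_sym. Qed.

Lemma vertex_sym G : connect_sym (grel (vertex_step G)).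
Proof.
apply: sym_connect_sym => c d; rewrite /= !inE.
by rewrite (inv_eq_swap (free_arcK G)) (inv_eq_swap ribbon_endK).
Qed.

Lemma boundary_sym G A : connect_sym (grel (boundary_step G A)).
Proof.
apply: sym_connect_sym => c d; rewrite /= !inE.
rewrite (inv_eq_swap (free_arcK G)); congr (_ || _).
case: ifP => cA; case: ifP => dA.
- exact: (inv_eq_swap ribbon_sideK).
- by apply/eqP/eqP => eq_cd; rewrite eq_cd /= in cA dA; rewrite cA in dA.
- by apply/eqP/eqP => eq_cd; rewrite eq_cd /= in cA dA; rewrite cA in dA.
exact: (inv_eq_swap ribbon_endK).
Qed.

Lemma component_sym G : connect_sym (grel (component_step G)).
Proof.
apply: sym_connect_sym => c d; rewrite /= !inE.
by rewrite (inv_eq_swap (free_arcK G)) (inv_eq_swap ribbon_endK)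
  (inv_eq_swap ribbon_sideK).
Qed.

(* The vertex-discs of the partial dual are the discs glued to the boundary
   components of [F_A]. *)
Lemma num_vertices_partial_dual G A :
  num_vertices (partial_dual G A) = num_boundary_components G A.
Proof.
apply: (congr1 (addn^~ (bare_discs G))).
rewrite (@adjunction_n_comp _ _ (swap_ends A) _ (grel (boundary_step G A))) //.
- exact: vertex_sym.
- exact: boundary_sym.
apply: strict_adjunction => //; [exact: boundary_sym | exact: inv_inj (swap_endsK A) | | ].
  by apply/subsetP => c _; apply/codomP; exists (swap_ends A c); rewrite swap_endsK.
move=> c d _.
have dualE x : free_arc (partial_dual G A) x = swap_ends A (free_arc G (swap_ends A x)) by [].
rewrite /grel /= /vertex_step dualE swap_endsK !inE.
rewrite (inj_eq (inv_inj (swap_endsK A))); congr (_ || _).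
rewrite (can2_eq (swap_endsK A) (swap_endsK A)); congr (_ == _).
case: c => [[e i] j]; rewrite /swap_ends /ribbon_end /ribbon_side /=.
by case eA: (e \in A); rewrite /= eA.
Qed.

Lemma F2_addrr (x : 'F_2) : x + x = 0.
Proof. exact: (addrr_pchar2 (pchar_Fp _)). Qed.

(* Functions on a finite type that are constant on the classes of a relation,
   as row vectors over F_2. *)
Section ClassMx.
Variables (T : finType) (e : rel T).
Hypothesis sym_e : connect_sym e.

Definition class_rep (i : 'I_(n_comp e predT)) : T := enum_val i.

Definition class_mx : 'M['F_2]_(n_comp e predT, #|T|) :=
  \matrix_(i, x) (fingraph.root e (enum_val x) == class_rep i)%:R.

Definition class_fun (w : 'rV['F_2]_#|T|) := forall x y : T,
  e x y -> w 0 (enum_rank x) = w 0 (enum_rank y).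

Lemma class_fun_connect w x y : class_fun w -> connect e x y ->
  w 0 (enum_rank x) = w 0 (enum_rank y).
Proof.
move=> cw /connectP[p + ->]; elim: p x => //= z p IHp x /andP[/cw-> /IHp].
by [].
Qed.

Lemma class_funP w : reflect (class_fun w) (w <= class_mx)%MS.
Proof.
apply: (iffP idP) => [/submxP[u ->] x y exy | cw].
  rewrite !mxE; apply: eq_bigr => i _; rewrite !mxE !enum_rankK.
  by rewrite (fingraph.rootP sym_e (connect1 exy)).
suff -> : w = (\row_i w 0 (enum_rank (class_rep i))) *m class_mx by exact: submxMl.
apply/rowP=> k; rewrite -(enum_valK k); move: (enum_val k) => x {k}.
have rx : fingraph.root e x \in predI (fingraph.roots e) predT by rewrite !inE roots_root.
rewrite !mxE (bigD1 (enum_rank_in rx (fingraph.root e x))) //= !mxE /class_rep enum_rankK.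
rewrite enum_rankK_in // eqxx mulr1 big1 ?addr0 => [|i ne_i].
  exact/class_fun_connect/connect_root.
rewrite !mxE /class_rep enum_rankK [fingraph.root e x == _]eq_sym.
case: eqP => [eq_i|]; last by rewrite mulr0.
by case/eqP: ne_i; apply: enum_val_inj; rewrite enum_rankK_in.
Qed.

Lemma rank_class_mx : \rank class_mx = n_comp e predT.
Proof.
apply/eqP; apply/row_freeP.
exists (\matrix_(x, i) (enum_val x == class_rep i)%:R).
apply/matrixP=> i j; rewrite !mxE (bigD1 (enum_rank (class_rep j))) //= !mxE.
rewrite enum_rankK eqxx mulr1 big1 ?addr0 => [|x ne_x].
  have /andP[/eqP-> _] := enum_valP j.
  by rewrite /class_rep (inj_eq enum_val_inj) eq_sym.
rewrite !mxE; case: (enum_val x =P class_rep j) => [eq_x|]; last by rewrite mulr0.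
by case/eqP: ne_x; rewrite -eq_x enum_valK.
Qed.

End ClassMx.

Definition diff_mx (T : finType) (a b : E -> T) : 'M['F_2]_(#|T|, #|E|) :=
  \matrix_(x, k) ((enum_val x == a (enum_val k))%:R
                  + (enum_val x == b (enum_val k))%:R).

Lemma mul_diff_mx (T : finType) (a b : E -> T) m (w : 'M['F_2]_(m, #|T|)) i k :
  (w *m diff_mx a b) i (enum_rank k) =
  w i (enum_rank (a k)) + w i (enum_rank (b k)).
Proof.
have sum1 x : \sum_j w i j * (enum_val j == x)%:R = w i (enum_rank x).
  rewrite (bigD1 (enum_rank x)) //= enum_rankK eqxx mulr1 big1 ?addr0 // => j ne_j.
  case: (enum_val j =P x) => [eq_x|]; last by rewrite mulr0.
  by case/eqP: ne_j; rewrite -eq_x enum_valK.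
rewrite !mxE -!sum1 -big_split /=; apply: eq_bigr => j _.
by rewrite !mxE enum_rankK mulrDr.
Qed.

(* If every function constant on the [e]-classes that agrees at [a k] and [b k]
   for all [k] is constant on the [f]-classes, the rank of the map
   [w |-> (w (a k) + w (b k))_k] bounds how many more classes [e] has. *)
Lemma n_comp_le_rank (T : finType) (e f : rel T) (a b : E -> T) :
    connect_sym e -> connect_sym f ->
    (forall w, class_fun e w ->
       (forall k, w 0 (enum_rank (a k)) = w 0 (enum_rank (b k))) -> class_fun f w) ->
  (n_comp e predT <= n_comp f predT + \rank (class_mx e *m diff_mx a b))%N.
Proof.
move=> sym_e sym_f ef; set K := kermx (class_mx e *m diff_mx a b).
have freeB : row_free (class_mx e) by rewrite /row_free rank_class_mx.
have : (K *m class_mx e <= class_mx f)%MS.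
  apply/row_subP => i; apply/class_funP => //; apply: ef => [|k].
    by apply/class_funP=> //; rewrite row_mul submxMl.
  apply: (addIr (row i (K *m class_mx e) 0 (enum_rank (b k)))); rewrite F2_addrr.
  by rewrite -mul_diff_mx -row_mul -mulmxA mulmx_ker row0 mxE.
move/mxrankS; rewrite mxrankMfree // mxrank_ker rank_class_mx // leq_subLR addnC; exact.
Qed.

Lemma sum_involution (T : finType) (t : T -> T) (F : T -> 'F_2) :
  involutive t -> (forall x, t x != x) -> (forall x, F (t x) = F x) ->
  \sum_x F x = 0.
Proof.
move=> tK t_neq Ft.
rewrite (bigID (fun x => (enum_rank x < enum_rank (t x))%N)) /=.
rewrite [X in _ + X](reindex_inj (inv_inj tK)) /=.
rewrite [X in _ + X](eq_bigr F) => [|x _]; last exact: Ft.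
rewrite [X in _ + X](eq_bigl (fun x => (enum_rank x < enum_rank (t x))%N)).
  exact: F2_addrr.
move=> x; rewrite tK -leqNgt leq_eqVlt.
by rewrite (inj_eq val_inj) (inj_eq enum_rank_inj) eq_sym (negbTE (t_neq x)).
Qed.

(* Functions constant on the vertices and functions constant on the faces have
   orthogonal differences in F_2^E: their pairing is a sum over all corners of
   a [free_arc]-invariant function. *)
Lemma euler_genus_ge0 G : 0 <= euler_genus G.
Proof.
pose eV := grel (vertex_step G); pose eF := grel (boundary_step G setT).
pose eC := grel (component_step G).
pose MV := class_mx eV *m diff_mx (fun k => (k, false, false)) (fun k => (k, true, false)).
pose MF := class_mx eF *m diff_mx (fun k => (k, false, false)) (fun k => (k, false, true)).
have leV : (n_comp eV predT <= n_comp eC predT + \rank MV)%N.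
  apply: n_comp_le_rank; [exact: vertex_sym | exact: component_sym |].
  move=> w wV wk c d; rewrite /= !inE => /or3P[] /eqP->.
  - by apply: wV; rewrite /= !inE eqxx.
  - by apply: wV; rewrite /= !inE eqxx orbT.
  have wE k i j : w 0 (enum_rank (k, i, j)) = w 0 (enum_rank (k, i, false)).
    by case: j => //; apply: wV; rewrite /= !inE eqxx orbT.
  case: c => [[k i] j]; rewrite [LHS]wE [RHS]wE /=.
  by case: i; [exact/esym/wk | exact: wk].
have leF : (n_comp eF predT <= n_comp eC predT + \rank MF)%N.
  apply: n_comp_le_rank; [exact: boundary_sym | exact: component_sym |].
  move=> w wF wk c d; rewrite /= !inE => /or3P[] /eqP->.
  - by apply: wF; rewrite /= !inE eqxx.
  - have wE k i j : w 0 (enum_rank (k, i, j)) = w 0 (enum_rank (k, false, j)).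
      by case: i => //; apply: wF; rewrite /= !inE eqxx orbT.
    case: c => [[k i] j]; rewrite [LHS]wE [RHS]wE /=.
    by case: j; [exact/esym/wk | exact: wk].
  by apply: wF; rewrite /= !inE eqxx orbT.
have orth : MV *m MF^T = 0.
  apply/matrixP=> p q; rewrite [LHS]mxE [RHS]mxE.
  pose f c := class_mx eV p (enum_rank c); pose g c := class_mx eF q (enum_rank c).
  have fP c d : eV c d -> f c = f d.
    have cV := elimT (class_funP (@vertex_sym G) _) (row_sub p (class_mx eV)).
    by move/cV; rewrite /f !mxE.
  have gP c d : eF c d -> g c = g d.
    have cF := elimT (class_funP (@boundary_sym G setT) _) (row_sub q (class_mx eF)).
    by move/cF; rewrite /g !mxE.
  have fgA c : f (free_arc G c) * g (free_arc G c) = f c * g c.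
    by rewrite (fP c (free_arc G c)) ?(gP c (free_arc G c)) //= !inE eqxx.
  rewrite -[RHS](sum_involution (@free_arcK _ G) (@free_arc_neq _ G) fgA).
  rewrite (reindex enum_rank) /=; last exact: onW_bij (enum_rank_bij _).
  have -> : \sum_c f c * g c =
      \sum_k \sum_i \sum_j f (k, i, j) * g (k, i, j).
    rewrite pair_bigA /= pair_bigA /=.
    by apply: eq_bigr => -[[k i] j] _.
  have MVE k : MV p (enum_rank k) = f (k, false, false) + f (k, true, false).
    exact: mul_diff_mx.
  have MFE k : MF q (enum_rank k) = g (k, false, false) + g (k, false, true).
    exact: mul_diff_mx.
  apply: eq_bigr => k _; rewrite [X in _ * X]mxE MVE MFE !big_bool /=.
  have fE i : f (k, i, true) = f (k, i, false).
    by apply: fP; rewrite /= !inE eqxx orbT.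
  have gE j : g (k, true, j) = g (k, false, j).
    by apply: gP; rewrite /= !inE eqxx orbT.
  rewrite !fE !gE !(mulrDl, mulrDr).
  by rewrite [LHS](AC (2*2) ((4*3)*(2*1)))%AC.
have rk := mulmx0_rank_max orth.
rewrite mxrank_tr in rk.
rewrite /euler_genus /num_vertices /num_faces /num_boundary_components.
rewrite /num_components -/eV -/eF -/eC.
rewrite subr_ge0 addrAC lerBrDr -!PoszD lez_nat.
rewrite addnACA mulnDr [leqRHS]addnAC !mul2n addnn leq_add2r.
apply: leq_trans (leq_add leF leV) _; rewrite addnACA addnn leq_add2l.
by rewrite addnC.
Qed.

End Checks.

Lemma num_vertices_ribbon_graph_of (C : finType) (D : chord_diagram C) :
  num_vertices (ribbon_graph_of D) = 1%N.
Proof.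
rewrite /num_vertices /=; set e := grel _; have [C0|] := eqVneq #|C| 0%N.
  by rewrite [n_comp _ _]eq_card0 // => -[[c i] j]; have := card0_eq C0 c.
rewrite -lt0n => /card_gt0P[c0 _]; rewrite addn0.
have sym_e : connect_sym e by exact: vertex_sym.
pose h (x : C * bool) : corner C := (x, x.2).
have h_next x : connect e (h x) (h (next (endpoints D) x)).
  apply: (@connect_trans _ _ (x, ~~ x.2)).
    by apply: connect1; rewrite /= !inE eqxx orbT.
  suff -> : h (next (endpoints D) x) = circle_free_arc D (x, ~~ x.2).
    by apply: connect1; rewrite /= !inE eqxx.
  by rewrite /circle_free_arc; case: (~~ x.2 =P x.2) => //; case: x.2.
have h_conn x y : connect e (h x) (h y).
  have := mem_endpoints D y.
  rewrite -(fconnect_cycle (cycle_next (endpoints_uniq D)) (mem_endpoints D x)).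
  case/connectP=> p + -> {y}; elim: p x => //= z p IHp x /andP[/eqP<- /IHp].
  exact: connect_trans.
have to_h (c : corner C) : connect e (h c.1) c.
  case: c => x j; rewrite /h /=; have [->|ne_j] := eqVneq j x.2; first exact: connect0.
  have -> : j = ~~ x.2 by case: x.2 j ne_j => [] [].
  by apply: connect1; rewrite /= !inE eqxx orbT.
rewrite -(n_comp_connect sym_e (h (c0, false))); apply: eq_n_comp_r => c.
by rewrite !inE (connect_trans (h_conn _ c.1) (to_h c)).
Qed.

(* Main.v *)
(* The vertices and faces of the partial dual G^A are the boundary components of
   F_A and of F_{A^c}, and G^A is connected, so the claim reduces to
     #(boundary components of F_A) = |A| + 1 - rank M_A.
   A function over F_2 constant on these boundary components amounts to a
   function on the arcs of the circle that jumps by the same amount u(c) at both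
   endpoints of a chord c of A, jumps nowhere else, and takes equal values on the
   arcs joined by the sides of each ribbon of A. Summing the jumps between the
   two endpoints of c turns the last condition into (M_A u)(c) = 0. Hence these
   functions form a space of dimension 1 + dim ker M_A. *)

Require Import Defs.
From mathcomp Require Import all_boot all_order all_algebra.
From mathcomp Require Import zify.

Local Open Scope ring_scope.

Set Implicit Arguments.
Unset Strict Implicit.
Unset Printing Implicit Defensive.

Import GRing.Theory.

(** * Order of endpoints under deletion of chords *)

(** A strict comparison of indices only records which element occurs first, and dropping entries
    outside the image of [g] preserves this. *)
Lemma index_pmap_lt (S T : eqType) (f : S -> option T) (g : T -> S) s y z :
    ocancel f g -> pcancel g f ->
  (index y (pmap f s) < index z (pmap f s))%N = (index (g y) s < index (g z) s)%N.
Proof.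
move=> fK gK; elim: s => //= x s IHs.
have eq_g t : (x == g t) = (f x == Some t).
  by apply/eqP/eqP=> [->|fx]; [exact: gK | have := fK x; rewrite fx].
rewrite !eq_g; case: (f x) => [t|] //=.
rewrite -[Some t == Some y]/(t == y) -[Some t == Some z]/(t == z).
by case: ifP; case: ifP.
Qed.

Lemma intersection_restrict (C : finType) (D : chord_diagram C) (A : {set C})
    (a b : {c : C | c \in A}) :
  intersection_graph (restrict_diagram D A) a b =
  intersection_graph D (val a) (val b).
Proof.
pose g (y : {c : C | c \in A} * bool) := (val y.1, y.2).
have gK : pcancel g (@restrict_endpoint C A).
  by case=> c i; rewrite /restrict_endpoint /= valK.
have lt y z : (index y (endpoints (restrict_diagram D A))
    < index z (endpoints (restrict_diagram D A)))%N =
    (index (g y) (endpoints D) < index (g z) (endpoints D))%N.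
  exact: index_pmap_lt (@restrict_endpointK C A) gK.
by rewrite /intersection_graph /between !lt.
Qed.

(** * Faces and components of the partial dual *)

Section Duality.
Variables (E : finType) (G : ribbon_graph E) (A : {set E}).

Let swap_inj : injective (swap_ends A) := inv_inj (swap_endsK A).

Lemma swap_ends_end c : swap_ends A (ribbon_end c) =
  if c.1.1 \in A then ribbon_side (swap_ends A c) else ribbon_end (swap_ends A c).
Proof.
case: c => [[e i] j]; rewrite /swap_ends /ribbon_end /ribbon_side /=.
by case: (e \in A).
Qed.

Lemma swap_ends_side c : swap_ends A (ribbon_side c) =
  if c.1.1 \in A then ribbon_end (swap_ends A c) else ribbon_side (swap_ends A c).
Proof.
case: c => [[e i] j]; rewrite /swap_ends /ribbon_end /ribbon_side /=.
by case: (e \in A).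
Qed.

Lemma swap_ends1 c : (swap_ends A c).1.1 = c.1.1.
Proof. by rewrite /swap_ends; case: ifP. Qed.

Lemma n_comp_swap_ends (e e' : rel (corner E)) :
    connect_sym e -> connect_sym e' ->
    (forall c d, e' (swap_ends A c) (swap_ends A d) = e c d) ->
  n_comp e predT = n_comp e' predT.
Proof.
move=> sym_e sym_e' ee'.
rewrite (@adjunction_n_comp _ _ (swap_ends A) e' e) //.
apply: strict_adjunction => //.
by apply/subsetP => c _; apply/codomP; exists (swap_ends A c); rewrite swap_endsK.
Qed.

Lemma eq_swap_free_arc c d :
  (swap_ends A d == free_arc G (swap_ends A c)) =
  (d == free_arc (partial_dual G A) c).
Proof. exact: can2_eq (swap_endsK A) (swap_endsK A) _ _. Qed.

(** In the dual, the sides of the ribbons in [A] are their former ends. A face thus follows the ends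
    of ribbons in [A] and the sides of the others, exactly as the boundary of the ribbon subgraph on
    [~: A] does. *)
Lemma num_faces_partial_dual :
  num_faces (partial_dual G A) = num_boundary_components G (~: A).
Proof.
apply: (congr1 (addn^~ (bare_discs G))).
apply: n_comp_swap_ends; [exact: boundary_sym | exact: boundary_sym |].
move=> c d; rewrite /= !inE eq_swap_free_arc; congr (_ || _).
rewrite swap_ends1 -(inj_eq swap_inj d) swap_ends_side.
by case: (c.1.1 \in A).
Qed.

Lemma num_components_partial_dual :
  num_components (partial_dual G A) = num_components G.
Proof.
apply: (congr1 (addn^~ (bare_discs G))).
apply: n_comp_swap_ends; [exact: component_sym | exact: component_sym |].
move=> c d; rewrite /= !inE eq_swap_free_arc; congr (_ || _).
rewrite -(inj_eq swap_inj d (ribbon_end c)) -(inj_eq swap_inj d (ribbon_side c)).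
rewrite swap_ends_side swap_ends_end.
by case: (c.1.1 \in A); rewrite // orbC.
Qed.

End Duality.

(** * Comparing class counts through dimensions over F_2 *)

Section ClassFunctions.
Variables (T : finType) (e : rel T).
Hypothesis sym_e : connect_sym e.

Lemma n_comp_gt0 : T -> (0 < n_comp e predT)%N.
Proof.
move=> x; apply/card_gt0P; exists (fingraph.root e x).
by rewrite !inE roots_root.
Qed.

(** Functions constant on the [f]-classes are constant on the [e]-classes, and the dimensions of
    these two spaces are the class counts. *)
Lemma n_comp_le (f : rel T) : connect_sym f ->
  (forall x y, e x y -> connect f x y) -> (n_comp f predT <= n_comp e predT)%N.
Proof.
move=> sym_f sub_ef; rewrite -(rank_class_mx e) -(rank_class_mx f).
apply/mxrankS/row_subP=> i; apply/(class_funP sym_e) => x y /sub_ef.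
by apply: class_fun_connect; apply/(class_funP sym_f); exact: row_sub.
Qed.

(* The constant functions lie in the kernel of the difference map. *)
Lemma rank_diff_lt (E : finType) (a b : E -> T) : T ->
  (\rank (class_mx e *m diff_mx a b) < n_comp e predT)%N.
Proof.
move=> x0; have /submxP[v v1] : ((const_mx 1 : 'rV['F_2]_#|T|) <= class_mx e)%MS.
  by apply/(class_funP sym_e) => x y _; rewrite !mxE.
have v0 : v != 0.
  apply/eqP=> v0; have /rowP/(_ (enum_rank x0)) := v1.
  by rewrite v0 mul0mx !mxE => /eqP; rewrite oner_eq0.
rewrite ltn_neqAle rank_leq_row andbT; apply: contra v0 => /row_freeP[B BK].
rewrite -(mulmx1 v) -BK !mulmxA -v1.
suff -> : const_mx 1 *m diff_mx a b = 0 :> 'rV_ _ by rewrite mul0mx.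
apply/rowP=> k; rewrite -(enum_valK k) mul_diff_mx !mxE.
exact: F2_addrr.
Qed.

End ClassFunctions.

(** * Jumps of functions along the circle *)

Section Circle.
Variables (C : finType) (D : chord_diagram C).
Let s := endpoints D.
Let p (x : C * bool) := index x s.

Lemma num_components_ribbon_graph_of : num_components (ribbon_graph_of D) = 1%N.
Proof.
have := num_vertices_ribbon_graph_of D; rewrite /num_components /num_vertices /=.
have [C0|] := eqVneq #|C| 0%N.
  by move=> _; rewrite [n_comp _ _]eq_card0 // => -[[c i] j]; have := card0_eq C0 c.
rewrite -lt0n => /card_gt0P[c0 _]; rewrite !addn0 => V1.
apply/eqP; rewrite eqn_leq; apply/andP; split; last first.
  exact: (n_comp_gt0 (@component_sym _ _) (c0, false, false)).
rewrite -V1; apply: n_comp_le; [exact: vertex_sym | exact: component_sym |].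
by move=> c d; rewrite /= !inE => cd; apply: connect1; rewrite /= !inE orbA cd.
Qed.

Lemma index_endpoint_inj : injective p.
Proof. by move=> x y; exact: index_inj (mem_endpoints D x) (mem_endpoints D y). Qed.

Lemma index_endpoint_lt x : (p x < size s)%N.
Proof. by rewrite index_mem mem_endpoints. Qed.

Lemma index_next_endpoint x : p (next s x) = if (p x).+1 == size s then 0 else (p x).+1.
Proof.
have := endpoints_uniq D; have := index_endpoint_lt x; have := mem_endpoints D x.
rewrite /p next_nth -/s; case: s => // y t -> lt_x uniq_t; rewrite -[size _]/(size t).+1 eqSS.
have [->|ne_x] := eqVneq; first by rewrite nth_default //= eqxx.
rewrite -[nth y t _]/(nth y (y :: t) (index x (y :: t)).+1) index_uniq //.
by rewrite ltn_neqAle lt_x -[size _]/(size t).+1 eqSS ne_x.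
Qed.

(* [f z] and [g z] are the values just before and just after the endpoint [z]. *)
Lemma arc_sum (f g : C * bool -> 'F_2) x y :
    (forall z, f (next s z) = g z) -> (p x < p y)%N ->
  g x + f y = \sum_(z | (p x < p z < p y)%N) (f z + g z).
Proof.
move=> fg; move def_n: (p y) => n; elim: n y def_n => // n IHn y py.
have lt_n : (n < size s)%N by rewrite -ltnS -py ltnS ltnW // index_endpoint_lt.
(* The endpoint immediately before [y]; the induction peels off its jump. *)
pose z := nth y s n; have pz : p z = n by rewrite /p index_uniq ?endpoints_uniq.
have <- : next s z = y.
  apply: index_endpoint_inj; rewrite index_next_endpoint pz py.
  by rewrite ltn_eqF // -py index_endpoint_lt.
rewrite fg ltnS leq_eqVlt => /predU1P[eq_x|lt_x].
  have -> : x = z by apply: index_endpoint_inj; rewrite pz.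
  by rewrite F2_addrr big_pred0 // => t; rewrite pz ltnS; case: ltngtP.
rewrite (bigD1 z) /= ?pz ?lt_x ?ltnSn //.
rewrite (eq_bigl (fun t => p x < p t < n)%N) => [|t].
  by rewrite -(IHn z pz lt_x) [RHS]addrC -[RHS]addrA (addrA (f z)) F2_addrr add0r.
rewrite ltnS -(inj_eq index_endpoint_inj) pz -andbA [_ && (_ != _)]andbC.
by rewrite -ltn_neqAle.
Qed.

(** Summing jumps over the arc cut off by [c], a chord with both endpoints there contributes [v a]
    twice, hence zero; only the chords crossing [c] survive. *)
Lemma arc_chord (f g : C * bool -> 'F_2) (v : C -> 'F_2) c :
    (forall z, f (next s z) = g z) -> (forall z, f z + g z = v z.1) ->
  g (c, false) + f (c, true) = \sum_a (intersection_graph D c a)%:R * v a.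
Proof.
move=> fg fgv; set x := (c, false); set y := (c, true).
transitivity (\sum_(z | between D x y z) v z.1).
  case: (ltngtP (p x) (p y)) => [lt_xy|lt_yx|/index_endpoint_inj//].
    rewrite (arc_sum fg lt_xy); apply: eq_big => [z|z _]; last exact: fgv.
    rewrite /between -/s -/(p x) -/(p y) -/(p z).
    case: (ltnP (p y) (p z)) => [lt_yz|_]; last by rewrite orbF.
    by rewrite [(p z < p x)%N]ltnNge (ltnW (ltn_trans lt_xy lt_yz)) orbF.
  (* [f] and [g] differ by [v c] at both [x] and [y]. *)
  have -> : g x + f y = g y + f x.
    apply: (addrI (f x)); rewrite addrA fgv -(fgv y) addrAC F2_addrr add0r.
    by rewrite (addrC (g y)) addrA F2_addrr add0r.
  rewrite (arc_sum fg lt_yx); apply: eq_big => [z|z _]; last exact: fgv.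
  rewrite /between -/s -/(p x) -/(p y) -/(p z).
  case: (ltnP (p x) (p z)) => //= lt_xz.
  by rewrite [(p z < p y)%N]ltnNge (ltnW (ltn_trans lt_yx lt_xz)).
rewrite big_mkcond -(pair_bigA _ (fun a i => if between D x y (a, i) then v a else 0)).
apply: eq_bigr => a _; rewrite big_bool /= /intersection_graph -/x -/y.
case: (between D x y (a, true)); case: (between D x y (a, false));
  by rewrite /= ?mul1r ?mul0r ?addr0 ?add0r ?F2_addrr.
Qed.

(** * Boundary components of the ribbon subgraph on [A] *)

Variable A : {set C}.
Let M := adjacency_mx (restrict_diagram D A).
Let e := grel (boundary_step (ribbon_graph_of D) A).
(** Its row space consists of the jump vectors of functions constant on the boundary components: the
    two corners compared are the first and second at the endpoint [(k, false)]. *)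
Let P := class_mx e *m diff_mx (fun k : {c | c \in A} => (val k, false, false))
                               (fun k => (val k, false, true)).

Let sym_e : connect_sym e. Proof. exact: boundary_sym. Qed.

(** The transpose makes the row-vector product read along row [k] of [M]. *)
Lemma sum_intersection (v : C -> 'F_2) (k : {c | c \in A}) :
    (forall a, a \notin A -> v a = 0) ->
  \sum_a (intersection_graph D (val k) a)%:R * v a =
    ((\row_j v (val (enum_val j))) *m M^T) 0 (enum_rank k).
Proof.
move=> v0; rewrite mxE (bigID (mem A)) /= [X in _ + X]big1 ?addr0 => [|a /v0->]; last first.
  by rewrite mulr0.
rewrite big_sub [RHS](reindex enum_rank) /=; last exact: onW_bij (enum_rank_bij _).
by apply: eq_bigr => a _; rewrite !mxE !enum_rankK intersection_restrict mulrC.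
Qed.

Lemma free_arc_first x : circle_free_arc D (x, x.2) = (prev s x, ~~ (prev s x).2).
Proof. by rewrite /circle_free_arc eqxx. Qed.

Lemma free_arc_second x : circle_free_arc D (x, ~~ x.2) = (next s x, (next s x).2).
Proof. by rewrite /circle_free_arc; case: x.2. Qed.

Lemma boundary_diff_ker (w : 'rV_#|corner C|) : class_fun e w ->
  w *m diff_mx (fun k : {c | c \in A} => (val k, false, false))
               (fun k => (val k, false, true)) *m M^T = 0.
Proof.
set d := diff_mx _ _ => we; pose W c := w 0 (enum_rank c).
have W_arc c : W (circle_free_arc D c) = W c by apply/esym/we; rewrite /= !inE eqxx.
have W_side c : c.1.1 \in A -> W (ribbon_side c) = W c.
  by move=> cA; apply/esym/we; rewrite /= !inE cA eqxx orbT.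
have W_end c : c.1.1 \notin A -> W (ribbon_end c) = W c.
  by move=> /negPf cA; apply/esym/we; rewrite /= !inE cA eqxx orbT.
pose v a := W (a, false, false) + W (a, false, true).
have v0 a : a \notin A -> v a = 0.
  by move=> aA; rewrite /v -(W_end (a, false, false)) //= F2_addrr.
pose f x := W (x, x.2); pose g x := W (x, ~~ x.2).
have fg z : f (next s z) = g z by rewrite /f /g -free_arc_second W_arc.
(* At [(a, true)] the sides of a ribbon in [A] bring back the two corners at [(a, false)] in reverse
   order, so the jump is the same; outside [A] the end of the ribbon forces it to vanish. *)
have fgv z : f z + g z = v z.1.
  case: z => a [] //; rewrite /f /g /=; have [aA|aA] := boolP (a \in A).
    by rewrite -!(W_side (a, true, _)) //= addrC.
  by rewrite v0 // -(W_end (a, true, false)) //= F2_addrr.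
have -> : w *m d = \row_j v (val (enum_val j)).
  by apply/rowP=> j; rewrite -(enum_valK j) mul_diff_mx mxE enum_rankK.
apply/rowP=> j; rewrite -(enum_valK j) -sum_intersection // -(arc_chord _ fg fgv) mxE.
(* One side of the ribbon joins the second corner at [(k, false)] to the first at [(k, true)], so
   the sum is twice one value. *)
rewrite /f /g /= -(W_side (_, true, true)) ?F2_addrr //=; exact: valP.
Qed.

Lemma ker_boundary_diff (u : 'rV_#|{: {c | c \in A}}|) : u *m M^T = 0 ->
  exists2 w, class_fun e w &
    u = w *m diff_mx (fun k : {c | c \in A} => (val k, false, false))
                     (fun k => (val k, false, true)).
Proof.
move=> uM; pose v a := if insub a is Some k then u 0 (enum_rank k) else 0.
have v0 a : a \notin A -> v a = 0 by rewrite /v => aA; rewrite insubN.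
have vE k : v (val k) = u 0 (enum_rank k) by rewrite /v valK.
have rowv : \row_j v (val (enum_val j)) = u.
  by apply/rowP=> j; rewrite mxE vE enum_valK.
(* Integrating the jumps prescribed by [v] along the circle. *)
pose H m := \sum_(z | (p z < m)%N) v z.1.
pose f x := H (p x); pose g x := H (p x).+1.
have fgv z : f z + g z = v z.1.
  rewrite /f /g /H (bigD1 (P := fun t => (p t < _.+1)%N) z) //=.
  rewrite [X in _ + (_ + X)](eq_bigl (fun t => p t < p z)%N) => [|t].
    by rewrite addrCA F2_addrr addr0.
  by rewrite ltnS -(inj_eq index_endpoint_inj) andbC -ltn_neqAle.
(* Each chord is met twice, so the total jump around the circle is zero and [H] closes up at the
   last endpoint. *)
have Hsize : H (size s) = 0.
  rewrite /H (eq_bigl predT) => [|z]; last exact: index_endpoint_lt.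
  rewrite -(pair_bigA _ (fun a i => v a)) big1 //= => a _.
  by rewrite big_bool /= F2_addrr.
have fg z : f (next s z) = g z.
  rewrite /f /g index_next_endpoint; case: eqP => // ->.
  by rewrite Hsize /H big_pred0.
pose W (c : corner C) := if c.2 == c.1.2 then f c.1 else g c.1.
have W_arc c : W (circle_free_arc D c) = W c.
  case: c => x j; have [->|] := eqVneq j x.2.
    rewrite free_arc_first /W /= eqxx; case: eqP => [|_]; first by case: (prev s x).2.
    by rewrite -fg next_prev // endpoints_uniq.
  move=> ne_j; have -> : j = ~~ x.2 by case: j x.2 ne_j => [] [].
  rewrite free_arc_second /W /= eqxx fg; case: eqP => //.
  by case: x.2.
(* The kernel condition makes the jumps along the arc cut off by [c] cancel, which matches the
   values along one side of the ribbon. *)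
have cross c : c \in A -> g (c, false) = f (c, true).
  move=> cA; apply: (addIr (f (c, true))); rewrite F2_addrr.
  by rewrite (arc_chord _ fg fgv) (sum_intersection (Sub c cA)) // rowv uM mxE.
have fgE a i j : f (a, i) + g (a, i) = f (a, j) + g (a, j) by rewrite !fgv.
have W_side c : c.1.1 \in A -> W (ribbon_side c) = W c.
  case: c => [[a i] j] /= aA; have g0 := cross a aA.
  (* The other side follows, since both endpoints jump by the same amount. *)
  have f0 : f (a, false) = g (a, true).
    by apply: (addIr (g (a, false))); rewrite (fgE a false true) g0 addrC.
  by rewrite /W /=; case: i j => [] [].
have W_end c : c.1.1 \notin A -> W (ribbon_end c) = W c.
  case: c => [[a i] j] /= aA; have fg0 : f (a, i) = g (a, i).
    by apply: (addIr (g (a, i))); rewrite fgv v0 // F2_addrr.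
  by rewrite /W /= fg0 !if_same.
exists (\row_k W (enum_val k)).
  move=> c d; rewrite /= !inE !mxE !enum_rankK => /orP[]/eqP->; first exact/esym/W_arc.
  by case: ifPn => [/W_side|/W_end].
apply/rowP=> j; rewrite -(enum_valK j) mul_diff_mx !mxE !enum_rankK /W /=.
by rewrite fgv /= vE.
Qed.

(** By the two preceding lemmas [P] and [kermx M^T] have the same row space; rank-nullity
    concludes. *)
Lemma rank_boundary_diff : (\rank P + \rank M)%N = #|A|.
Proof.
have cardA : #|A| = #|{: {c | c \in A}}| by rewrite card_sig; apply: eq_card.
have PK : (P <= kermx M^T)%MS.
  apply/sub_kermxP/row_matrixP => i; rewrite row0 row_mul /P row_mul.
  by apply: boundary_diff_ker; apply/(class_funP sym_e); exact: row_sub.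
have KP : (kermx M^T <= P)%MS.
  apply/row_subP=> i.
  have [|w we ->] := @ker_boundary_diff (row i (kermx M^T)).
    by rewrite -row_mul mulmx_ker row0.
  by apply: submxMr; apply/(class_funP sym_e).
have -> : \rank P = \rank (kermx M^T) by apply: eqmx_rank; rewrite PK.
by rewrite mxrank_ker mxrank_tr subnK ?rank_leq_row -?cardA.
Qed.

(** What remains is that the count is one more than [\rank P]. A function without jumps is constant
    on the boundary of the single vertex-disc, which bounds the count above; the constants, killed
    by the difference map, bound it below. *)
Lemma num_boundary_ribbon_graph_of :
  (num_boundary_components (ribbon_graph_of D) A + \rank M)%N = #|A|.+1.
Proof.
rewrite -rank_boundary_diff -addSn; congr (_ + _)%N.
apply/eqP; rewrite eqn_leq; apply/andP; split.
  have := num_vertices_ribbon_graph_of D; rewrite /num_vertices => V1.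
  suff: (n_comp e predT + (#|C| == 0%N) <=
         n_comp (grel (vertex_step (ribbon_graph_of D))) predT + (#|C| == 0%N) + \rank P)%N.
    by rewrite V1.
  rewrite addnAC leq_add2r.
  apply: n_comp_le_rank; [exact: boundary_sym | exact: vertex_sym |].
  move=> w we wk c d; rewrite /= !inE => /orP[]/eqP->.
    by apply: we; rewrite /= !inE eqxx.
  have [cA|cA] := boolP (c.1.1 \in A); last first.
    by apply: we; rewrite /= !inE (negPf cA) eqxx orbT.
  have wk0 := wk (Sub c.1.1 cA).
  (* [wk] only concerns the end [(a, false)]; the sides transport it to the other end. *)
  have wE i j : w 0 (enum_rank (c.1.1, i, j)) = w 0 (enum_rank (c.1.1, false, j)).
    by case: i => //; apply: we; rewrite /= !inE cA eqxx orbT.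
  case: c cA wk0 wE => [[a i] j] /= cA wk0 wE; rewrite [LHS]wE [RHS]wE.
  by case: j.
(* Without chords there are no corners, and the bare disc supplies the one boundary component. *)
rewrite /num_boundary_components /=; have [C0|] := eqVneq #|C| 0%N.
  rewrite addn1 ltnS; apply: leq_trans (rank_leq_row _) _.
  by rewrite [n_comp _ _]eq_card0 // => -[[c i] j]; have := card0_eq C0 c.
rewrite -lt0n => /card_gt0P[c0 _]; rewrite addn0.
exact: (rank_diff_lt sym_e _ _ (c0, false, false)).
Qed.

End Circle.

Theorem theorem1p1 (C : finType) (D : chord_diagram C) :
  partial_dual_genus_poly (ribbon_graph_of D) =
  \sum_(A : {set C})
    'X^(\rank (adjacency_mx (restrict_diagram D A))
        + \rank (adjacency_mx (restrict_diagram D (~: A)))) :> {poly int}.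
Proof.
apply: eq_bigr => A _; congr ('X^_).
rewrite /euler_genus num_faces_partial_dual num_components_partial_dual.
rewrite num_components_ribbon_graph_of num_vertices_partial_dual.
have := num_boundary_ribbon_graph_of D A.
have := num_boundary_ribbon_graph_of D (~: A).
(* With r and r' the two ranks, the genus is [2 - (#|A| + 1 - r) + #|C| - (#|~: A| + 1 - r')], which
   is r + r' because [#|A| + #|~: A| = #|C|]. *)
rewrite -(cardsC A); lia.
Qed.
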